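(* Let $n\ge1$, let $X_0\sim\mathcal N(\mu_0,\sigma_0^2)$ and, independently, $X_1,\dots,X_n$ i.i.d. $\mathcal N(\mu,\sigma^2)$, with $\mu_0,\mu\in\mathbb R$, $\sigma_0,\sigma\in(0,\infty)$; put $\delta:=(\mu-\mu_0)/\sigma_0$, $\rho:=\sigma/\sigma_0$, and let $R_i:=\sum_{j=0}^n\mathbf 1_{\{X_j\le X_i\}}$ for $0\le i\le n$. Let $1\le m\le n$, choose indices $1\le i_1<\cdots<i_m\le n$, and let $j_0,j_1,\dots,j_m$ be $m+1$ distinct elements of $\{1,2,\dots,n+1\}$. Then $$\Pr(R_0=j_0,R_{i_1}=j_1,\dots,R_{i_m}=j_m)=\frac{\Pr(R_0=j_0)}{n(n-1)\cdots(n-m+1)},$$ $$\Pr(R_{i_1}=j_1,R_{i_2}=j_2,\dots,R_{i_m}=j_m)=\frac{1-\sum_{k=1}^m\Pr(R_0=j_k)}{n(n-1)\cdots(n-m+1)}.$$ Moreover, with $Z_{\rho,\delta}:=\Phi((X_0-\mu)/\sigma)$, $U\sim\mathrm{Uniform}\{1,\dots,n\}$ and $(V,W)\sim\mathrm{Uniform}\{(i,j)\in\{1,\dots,n\}^2:i\ne j\}$, define $\mu_Z:=\mathbb E Z_{\rho,\delta}$, $\bar\mu_Z:=1-\mu_Z$, $v_Z:=\mathrm{Var}(Z_{\rho,\delta})$, $\iota_{\rho,\delta}:=\frac{v_Z}{\mu_Z\bar\mu_Z}$, $\mu_U:=\frac{n+1}2=\mathbb E U$, $v_U:=\frac{n^2-1}{12}=\mathrm{Var}(U)$,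 $c_{1,2}:=-\frac{n+1}{12}=\mathrm{Cov}(V,W)$. Then $$\mathbb E R_1=\mu_U+\bar\mu_Z,$$ $$\mathrm{Var}(R_1)=v_U+n\mu_Z\bar\mu_Z\Big[1-\frac{(n-1)\iota_{\rho,\delta}}{n}\Big],$$ $$\mathrm{Cov}(R_0,R_1)=-\mu_Z\bar\mu_Z\big[1+(n-1)\iota_{\rho,\delta}\big],$$ $$\mathrm{Cov}(R_1,R_2)=c_{1,2}+2\mu_Z\bar\mu_Z\big[\iota_{\rho,\delta}-\tfrac12\big]\quad(\text{when }n\ge2),$$ and finally $\mathbb E R_0=1+n\mu_Z$ and $\mathrm{Var}(R_0)=-n\,\mathrm{Cov}(R_0,R_1)$.
   Context: $\Phi$ is the standard normal CDF. $R_i$ is the rank of $X_i$ among $X_0,\dots,X_n$ (ranks are almost surely distinct). $\iota_{\rho,\delta}$ is the intra-class correlation $\mathrm{Cor}(\mathbf 1_{\{X_1\le X_0\}},\mathbf 1_{\{X_2\le X_0\}})$. The pair $(V,W)$, $c_{1,2}$ as a covariance, and $R_2$ are only meaningful for $n\ge2$. For reference, $\mu_Z=\Phi(-\delta/\sqrt{\rho^2+1})$. *)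

(* Defs.v *)
From HB Require Import structures.
From mathcomp Require Import all_boot all_order all_algebra.
From mathcomp Require Import all_classical all_reals all_analysis.

Set Implicit Arguments.
Unset Strict Implicit.
Unset Printing Implicit Defensive.

Import Order.TTheory GRing.Theory Num.Theory.
Import numFieldNormedType.Exports.

Local Open Scope classical_set_scope.
Local Open Scope ring_scope.

(* CDF of the standard normal law; the second parameter of [normal_prob] is
   the standard deviation, not the variance. *)
Definition Phi {R : realType} (x : R) : R := fine (normal_prob 0 1 `]-oo, x]).

(* The equality of laws is required on measurable sets only: off the
   sigma-algebra the values of [P] and [normal_prob] are meaningless. *)
Definition normal_rv d (T : measurableType d) (R : realType)
    (P : probability T R) (Y : {RV P >-> R}) (m s : R) : Prop :=
  forall A : set R, measurable A -> distribution P Y A = normal_prob m s A.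

Definition mutually_independent d (T : measurableType d) (R : realType)
    (P : probability T R) (I : finType) (X : I -> {RV P >-> R}) : Prop :=
  forall (J : {set I}) (B : I -> set R), (forall i, measurable (B i)) ->
    P (\big[setI/setT]_(i in J) (X i @^-1` B i)) =
    (\prod_(i in J) P (X i @^-1` B i))%E.

(* Uniform law on the finite set of the elements of [s]; the values outside
   [s] need not be mentioned, since the masses below already add up to 1. *)
Definition uniform_rv d (T : measurableType d) (R : realType)
    (P : probability T R) d' (T' : measurableType d') (Y : T -> T')
    (s : seq T') : Prop :=
  forall y, y \in s -> P (Y @^-1` [set y]) = ((size (undup s))%:R^-1)%:E.

Definition distinct_pairs (n : nat) : seq (nat * nat) :=
  [seq p <- [seq (i, j) | i <- iota 1 n, j <- iota 1 n] | p.1 != p.2].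

Definition sample_rank (T : Type) (R : realType) (n : nat)
    (X : 'I_n.+1 -> T -> R) (i : 'I_n.+1) (w : T) : nat :=
  (\sum_(j < n.+1) (X j w <= X i w)%R)%N.

(* Main.v *)
Require Import Defs.
From HB Require Import structures.
From mathcomp Require Import all_boot all_order all_algebra all_fingroup.
From mathcomp Require Import all_classical all_reals all_analysis.
From mathcomp Require Import measurable_realfun ring lra.

(** Almost surely the sample has no ties, because the variables are independent
    and have no atoms; the ranks then form a random permutation [s] of the
    indices, and everything asked about the ranks is a statement about the
    finitely many weights [p s = P (rank_event s)].  The one probabilistic fact
    that drives the proof is that permuting [X_1, ..., X_n] does not change the
    law of the sample, so [p (t * s) = p s] whenever [t] fixes [0]
    ([sample_exchangeable], [rank_event_exch]).  Hence [p s] depends on [s ord0]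
    only: given [R_0], all arrangements of the other ranks are equally likely.

    The joint laws follow by counting.  The permutations that take [m + 1]
    prescribed values are [(n - m)!] in number ([card_perm_agree]), against [n!]
    for those that only have [s ord0] prescribed; summing over the value of
    [R_0] gives the second formula ([joint_law0], [joint_law]).

    For the moments, a function of [(R_0, R_i)] has the same mean for all
    [i != 0], so that [n] times this mean is the mean of a sum over all values
    but [R_0], and such a sum is a function of [R_0] alone ([rank_mean_exch1]);
    two indices are treated by repeating the argument ([rank_mean_exch2]).  Thus
    all means and covariances reduce to the first two moments of [R_0].  Now
    [R_0 - 1] counts the [j != 0] with [X_j <= X_0]; conditionally on [X_0] these
    events are independent of probability [Z], as centring and scaling turn the
    law of [X_j] into the standard normal one ([normal_prob_standardize]); so
    their probabilities and those of their pairwise intersections are [E Z] and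
    [E Z^2] ([prob_below], [prob_below2]), whence [E R_0] and [E R_0^2].

    The moments of [U] and of [(V, W)] are sums over finite sets
    ([uniform_mean_var], [uniform_pair_cov]). *)

Set Implicit Arguments.
Unset Strict Implicit.
Unset Printing Implicit Defensive.

Import Order.TTheory GRing.Theory Num.Theory.
Import numFieldNormedType.Exports.

Local Open Scope ring_scope.

(** * Permutations with prescribed values *)

(** Composing with the inverse of [s0] turns the permutations that agree with
    [s0] on [A] into those supported by the complement of [A]. *)
Lemma card_perm_agree (T : finType) (A : {set T}) (s0 : {perm T}) :
  #|[pred s : {perm T} | [forall x in A, s x == s0 x]]| = (#|~: A|)`!.
Proof.
rewrite -card_perm -[RHS](card_imset _ (mulIg s0)); apply: eq_card => s.
rewrite inE; apply/forall_inP/imsetP => [h|[u hu ->] x xA].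
  exists (s * s0^-1)%g; last by rewrite mulgKV.
  apply/fintype.subsetP => x; rewrite !inE; apply: contraR.
  rewrite negbK => xA; rewrite permM -(inj_eq (perm_inj (s := s0))) permKV.
  exact: h.
by rewrite permM (out_perm hu)// inE xA.
Qed.

(** The values are adjusted one at a time: once the first [m] are right, the
    transposition that corrects the next one moves none of them. *)
Lemma perm_extends (T : finType) (m : nat) (f g : 'I_m -> T) :
  injective f -> injective g -> exists s : {perm T}, forall k, s (f k) = g k.
Proof.
elim: m f g => [|m IH] f g fI gI; first by exists 1%g => -[].
have wI : injective (widen_ord (leqnSn m)).
  by move=> x y /(congr1 val) xy; exact: val_inj.
have [s hs] := IH _ _ (inj_comp fI wI) (inj_comp gI wI).
exists (s * tperm (s (f ord_max)) (g ord_max))%g => k; rewrite permM.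
have [->|km] := eqVneq k ord_max; first by rewrite tpermL.
have kltm : (k < m)%N.
  by rewrite ltn_neqAle -ltnS ltn_ord andbT; apply: contra_neq km => e; exact: val_inj.
have kE : k = widen_ord (leqnSn m) (Ordinal kltm) by exact: val_inj.
have sk : s (f k) = g k by rewrite kE hs.
rewrite sk tpermD //.
  by rewrite -sk (inj_eq perm_inj) (inj_eq fI) eq_sym.
by rewrite (inj_eq gI) eq_sym.
Qed.

(** * Sums of integers and of squares *)

Lemma sum_ord_succ (R : realFieldType) m :
  \sum_(a < m) (a.+1%:R : R) = (m * m.+1)%:R / 2.
Proof.
elim: m => [|m IH]; first by rewrite big_ord0 mul0n mul0r.
by rewrite big_ord_recr/= IH !natrM -!natr1; field.
Qed.

Lemma sum_ord_succ_sqr (R : realFieldType) m :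
  \sum_(a < m) (a.+1%:R * a.+1%:R : R) = (m * m.+1 * (2 * m + 1))%:R / 6.
Proof.
elim: m => [|m IH]; first by rewrite big_ord0 !mul0n mul0r.
by rewrite big_ord_recr/= IH !natrM !natrD !natrM -!natr1; field.
Qed.

(** * Random permutations exchangeable outside 0 *)

Section exchangeable_ranks.
Variables (R : realFieldType) (n : nat) (p : 'S_n.+1 -> R).
Hypothesis p_exch : forall t s : 'S_n.+1, t ord0 = ord0 -> p (t * s)%g = p s.
Hypothesis p_sum1 : \sum_s p s = 1.

Lemma weight_eq (s s' : 'S_n.+1) : s ord0 = s' ord0 -> p s = p s'.
Proof.
move=> e; rewrite -[s](mulgKV s') p_exch// permM e permK//.
Qed.

(** As [i ord0 = ord0], all the permutations of the sum have the same value at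
    [ord0], hence the same weight. *)
Lemma sum_weight_agree m (i j : 'I_m.+1 -> 'I_n.+1) (s0 : 'S_n.+1) :
  injective i -> i ord0 = ord0 -> (forall k, s0 (i k) = j k) ->
  \sum_(s : 'S_n.+1 | [forall k, s (i k) == j k]) p s = ((n - m)`!)%:R * p s0.
Proof.
move=> iI i0 s0E.
rewrite (eq_bigr (fun=> p s0)); last first.
  by move=> s /forallP/(_ ord0)/eqP; rewrite i0 -s0E i0 => /weight_eq.
rewrite sumr_const mulr_natl; congr (_ *+ _).
have -> : (n - m = #|~: [set i k | k in 'I_m.+1]|)%N.
  by rewrite cardsCs finset.setCK card_imset// !card_ord subSS.
rewrite -(card_perm_agree _ s0); apply: eq_card => s; rewrite !inE.
apply/forallP/forall_inP => [h _ /imsetP[k _ ->]|h k].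
  by rewrite s0E.
by rewrite -s0E h// imset_f.
Qed.

(** Both sides are multiples of the weight of one permutation [s0] that takes the
    prescribed values: by [(n - m)!] and by [n! / n ^_ m]. *)
Lemma joint_law0 m (i j : 'I_m.+1 -> 'I_n.+1) :
  injective i -> i ord0 = ord0 -> injective j ->
  \sum_(s : 'S_n.+1 | [forall k, s (i k) == j k]) p s =
  (\sum_(s : 'S_n.+1 | s ord0 == j ord0) p s) / (n ^_ m)%:R.
Proof.
move=> iI i0 jI.
have mn : (m <= n)%N.
  by have := leq_card _ iI; rewrite !card_ord.
have [s0 s0E] := perm_extends iI jI.
rewrite (sum_weight_agree iI i0 s0E).
have -> : \sum_(s : 'S_n.+1 | s ord0 == j ord0) p s =
    \sum_(s : 'S_n.+1 | [forall k : 'I_1, s ord0 == j ord0]) p s.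
  by apply: eq_bigl => s; apply/idP/forallP => [h _//|/(_ ord0)].
rewrite (@sum_weight_agree 0 (fun=> ord0) (fun=> j ord0) s0)//; last 2 first.
- by move=> a b _; rewrite !ord1.
- by move=> _; rewrite -s0E i0.
rewrite subn0 -(ffact_fact mn) natrM.
by rewrite mulrAC [X in _ = X * _]mulrAC mulfV ?mul1r// pnatr_eq0 -lt0n ffact_gt0.
Qed.

(** The law without the value at [ord0] is obtained by summing [joint_law0] over
    this value [a], which must avoid the values [j k] taken elsewhere. *)
Lemma joint_law m (i j : 'I_m -> 'I_n.+1) :
  injective i -> (forall k, i k != ord0) -> injective j ->
  \sum_(s : 'S_n.+1 | [forall k, s (i k) == j k]) p s =
  (1 - \sum_(k < m) \sum_(s : 'S_n.+1 | s ord0 == j k) p s) / (n ^_ m)%:R.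
Proof.
move=> iI i0 jI; rewrite -[X in X - _]p_sum1.
pose q a := \sum_(s : 'S_n.+1 | s ord0 == a) p s.
have sum_q : \sum_s p s = \sum_a q a.
  by rewrite (partition_big (fun s : 'S_n.+1 => s ord0) xpredT).
have sum_qj : \sum_(a in codom j) q a = \sum_(k < m) q (j k).
  by rewrite -big_uniq ?big_image//; apply/injectiveP.
rewrite sum_q (bigID (fun a => a \in codom j))/= sum_qj [X in X / _]addrC addKr.
rewrite mulr_suml (partition_big (fun s : 'S_n.+1 => s ord0) xpredT)//=.
rewrite (bigID (fun a => a \in codom j))/= big1 ?add0r => [|a /codomP[k ak]].
  apply: eq_bigr => a aj.
  pose i' k := oapp i ord0 (unlift ord0 k).
  pose j' k := oapp j a (unlift ord0 k).
  have i'I : injective i'.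
    rewrite /i' => k l; case: unliftP => [k'|] ->; case: unliftP => [l'|] -> //=.
    - by move=> /iI ->.
    - by move/eqP; rewrite (negbTE (i0 _)).
    - by move/esym/eqP; rewrite (negbTE (i0 _)).
  have j'I : injective j'.
    rewrite /j' => k l; case: unliftP => [k'|] ->; case: unliftP => [l'|] -> //=.
    - by move=> /jI ->.
    - by move=> jE; rewrite -jE codom_f in aj.
    - by move=> jE; rewrite jE codom_f in aj.
  have i'0 : i' ord0 = ord0 by rewrite /i' unlift_none.
  have -> : q a = \sum_(s : 'S_n.+1 | s ord0 == j' ord0) p s.
    by rewrite /j' unlift_none.
  rewrite -(joint_law0 i'I i'0 j'I); apply: eq_bigl => s.
  apply/andP/forallP => [[/forallP h s0] k|h].
    by rewrite /i' /j'; case: unliftP => [k'|] _ /=.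
  split; last by have := h ord0; rewrite i'0 /j' unlift_none.
  by apply/forallP => k; have := h (lift ord0 k); rewrite /i' /j' liftK.
rewrite big_pred0// => s; apply/negbTE/negP => /andP[/forallP/(_ k)/eqP sk].
by rewrite ak -sk (inj_eq perm_inj) eq_sym (negbTE (i0 k)).
Qed.

Definition rank_mean (f : 'S_n.+1 -> R) := \sum_s p s * f s.

Lemma rank_meanD f g :
  rank_mean (fun s => f s + g s) = rank_mean f + rank_mean g.
Proof. by rewrite -big_split; apply: eq_bigr => s _; rewrite mulrDr. Qed.

Lemma rank_meanZ c f : rank_mean (fun s => c * f s) = c * rank_mean f.
Proof. by rewrite mulr_sumr; apply: eq_bigr => s _; rewrite mulrCA. Qed.

Lemma rank_mean_cst c : rank_mean (fun=> c) = c.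
Proof. by rewrite /rank_mean -mulr_suml p_sum1 mul1r. Qed.

Lemma rank_mean_sum (I : finType) (D : pred I) (f : I -> 'S_n.+1 -> R) :
  rank_mean (fun s => \sum_(k | D k) f k s) = \sum_(k | D k) rank_mean (f k).
Proof.
by rewrite exchange_big; apply: eq_bigr => s _; rewrite mulr_sumr.
Qed.

Lemma eq_rank_mean f g : f =1 g -> rank_mean f = rank_mean g.
Proof. by move=> fg; apply: eq_bigr => s _; rewrite fg. Qed.

(** Reindexing by [t], which is the only way in which exchangeability enters the
    computation of moments. *)
Lemma rank_mean_perm (t : 'S_n.+1) f :
  t ord0 = ord0 -> rank_mean (fun s => f (t * s)%g) = rank_mean f.
Proof.
move=> t0; rewrite [RHS](reindex_inj (mulgI t)).
by apply: eq_bigr => s _; rewrite p_exch.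
Qed.

(** The mean is the same for the [n] indices [i != ord0], and their values are
    all the values but [s ord0]. *)
Lemma rank_mean_exch1 (i : 'I_n.+1) (f : 'I_n.+1 -> 'I_n.+1 -> R) : i != ord0 ->
  n%:R * rank_mean (fun s => f (s ord0) (s i)) =
  rank_mean (fun s => \sum_a f (s ord0) a - f (s ord0) (s ord0)).
Proof.
move=> i0; transitivity
    (\sum_(k | k != ord0) rank_mean (fun s => f (s ord0) (s k))).
  have cardN0 : #|predC1 (ord0 : 'I_n.+1)| = n by rewrite cardC1 card_ord.
  rewrite mulr_natl -[X in _ *+ X]cardN0 -sumr_const.
  apply: eq_bigr => k k0.
  rewrite -(@rank_mean_perm (tperm i k)) ?tpermD//.
  by apply: eq_rank_mean => s; rewrite !permM tpermL tpermD.
rewrite -rank_mean_sum; apply: eq_rank_mean => s.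
rewrite [in RHS](reindex_inj (@perm_inj _ s))/=.
by rewrite [in RHS](bigD1 ord0)//= [RHS]addrAC subrr add0r.
Qed.

Lemma card_nonzero_but (i : 'I_n.+1) : i != ord0 ->
  #|[pred l : 'I_n.+1 | (l != ord0) && (l != i)]| = n.-1.
Proof.
move=> i0; have := cardC1 (ord0 : 'I_n.+1); rewrite card_ord /= => cardN0.
rewrite -[in RHS]cardN0 (cardD1 i (predC1 _)) inE/= i0 add1n/=.
by apply: eq_card => l; rewrite !inE andbC.
Qed.

(** The same argument for the [n.-1] indices other than [ord0] and [i]; the
    result involves [s ord0] and [s i] only, so that [rank_mean_exch1] applies
    to it in turn. *)
Lemma rank_mean_exch2 (i k : 'I_n.+1) (f : 'I_n.+1 -> 'I_n.+1 -> R) :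
  i != ord0 -> k != ord0 -> i != k ->
  n.-1%:R * rank_mean (fun s => f (s i) (s k)) =
  rank_mean (fun s => \sum_a f (s i) a - f (s i) (s i) - f (s i) (s ord0)).
Proof.
move=> i0 k0 ik; transitivity
    (\sum_(l | (l != ord0) && (l != i)) rank_mean (fun s => f (s i) (s l))).
  rewrite mulr_natl -(card_nonzero_but i0) -sumr_const.
  apply: eq_bigr => l /andP[l0 li].
  rewrite -(@rank_mean_perm (tperm k l)) ?tpermD//.
  by apply: eq_rank_mean => s; rewrite !permM tpermL tpermD// eq_sym.
rewrite -rank_mean_sum; apply: eq_rank_mean => s.
rewrite [in RHS](reindex_inj (@perm_inj _ s))/=.
rewrite [in RHS](bigD1 ord0)//= [in RHS](bigD1 i)//=; ring.
Qed.

(** Ranks start at 1 while the values of a permutation start at 0. *)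
Let rank (s : 'S_n.+1) i : R := (s i).+1%:R.

Definition rank_covariance i k := rank_mean (fun s => (rank s i - rank_mean (rank^~ i)) *
   (rank s k - rank_mean (rank^~ k))).

Lemma rank_covarianceE i k : rank_covariance i k =
  rank_mean (fun s => rank s i * rank s k) - rank_mean (rank^~ i) * rank_mean (rank^~ k).
Proof.
rewrite /rank_covariance; set a := rank_mean (rank^~ i); set b := rank_mean (rank^~ k).
rewrite (@eq_rank_mean _ (fun s => rank s i * rank s k +
   (- b * rank s i + (- a * rank s k + a * b)))); last by move=> s; ring.
by rewrite 3!rank_meanD !rank_meanZ rank_mean_cst -/a -/b; ring.
Qed.

(** The term [1] counts the index [ord0] itself. *)
Lemma rank_sum s :
  rank s ord0 = 1 + \sum_(j | j != ord0) (s j <= s ord0)%N%:R.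
Proof.
rewrite /rank; set m := s ord0.
have -> : 1 + \sum_(j | j != ord0) (s j <= m)%N%:R =
    \sum_(a < n.+1) (a <= m)%N%:R :> R.
  by rewrite [RHS](reindex_inj (@perm_inj _ s))/= [RHS](bigD1 ord0)//= leqnn.
rewrite -natr_sum; congr _%:R.
rewrite -(big_mkord xpredT (fun a => nat_of_bool (a <= m)%N)).
have small : (\sum_(0 <= a < m.+1) (a <= m)%N = m.+1)%N.
  rewrite big_nat (eq_bigr (fun=> 1%N)) => [|a /andP[_ am]].
    by rewrite -big_nat sum_nat_const_nat subn0 muln1.
  by rewrite -ltnS am.
have large : (\sum_(m.+1 <= a < n.+1) (a <= m)%N = 0)%N.
  by rewrite big_nat big1// => a /andP[am _]; rewrite leqNgt am.
by rewrite (@big_cat_nat _ _ _ m.+1)//= small large addn0.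
Qed.

(** The rank of [ord0] is a sum of indicators, and its first two moments only
    involve the mean [mu] of an indicator and the mean [kappa] of the product of
    two distinct ones.  The difference [v] below is their covariance. *)
Section moments.
Variables mu kappa : R.
Hypothesis mean_lt : forall j, j != ord0 ->
  rank_mean (fun s => (s j <= s ord0)%N%:R) = mu.
Hypothesis mean_lt2 : forall j k, j != ord0 -> k != ord0 -> j != k ->
  rank_mean (fun s => (s j <= s ord0)%N%:R * (s k <= s ord0)%N%:R) = kappa.

Lemma rank0_mean : rank_mean (rank^~ ord0) = 1 + n%:R * mu.
Proof.
rewrite (eq_rank_mean rank_sum) rank_meanD rank_mean_cst rank_mean_sum.
rewrite (eq_bigr (fun=> mu))//; rewrite sumr_const cardC1 card_ord.
by rewrite mulr_natl.
Qed.

Lemma rank0_mean_sqr : rank_mean (fun s => rank s ord0 * rank s ord0) =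
  1 + 3 * n%:R * mu + n%:R * (n%:R - 1) * kappa.
Proof.
pose D (s : 'S_n.+1) : R := \sum_(j | j != ord0) (s j <= s ord0)%N%:R.
have D1 : rank_mean D = n%:R * mu.
  have := rank0_mean; rewrite (eq_rank_mean rank_sum) rank_meanD rank_mean_cst.
  exact: addrI.
(* The square of a sum of [n] indicators has [n] diagonal terms, which are
   idempotent and have mean [mu], and [n * (n - 1)] mixed ones. *)
have D2 : rank_mean (fun s => D s * D s) =
    n%:R * mu + n%:R * (n%:R - 1) * kappa.
  rewrite (@eq_rank_mean _ (fun s => \sum_(j | j != ord0) \sum_(k | k != ord0)
    ((s j <= s ord0)%N%:R * (s k <= s ord0)%N%:R))); last first.
    by move=> s; rewrite /D big_distrlr.
  rewrite rank_mean_sum (eq_bigr (fun=> mu + (n%:R - 1) * kappa)).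
    by rewrite sumr_const cardC1 card_ord -mulr_natl; ring.
  move=> j j0; rewrite rank_mean_sum (bigD1 j)//=; congr (_ + _).
    rewrite -(mean_lt j0); apply: eq_rank_mean => s.
    by rewrite -natrM mulnb andbb.
  rewrite (eq_bigr (fun=> kappa)) => [|k /andP[k0 kj]]; last first.
    by rewrite mean_lt2// eq_sym.
  rewrite sumr_const -[LHS]mulr_natl; congr (_ * _).
  rewrite card_nonzero_but//.
  case: n j j0 {D D1} => [|m] j j0; last by rewrite -natr1 addrK.
  by rewrite (ord1 j) eqxx in j0.
rewrite (@eq_rank_mean _ (fun s => 1 + (2 * D s + D s * D s))); last first.
  by move=> s; rewrite rank_sum -/(D s); ring.
by rewrite 2!rank_meanD rank_meanZ rank_mean_cst D1 D2; ring.
Qed.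

Lemma natr_neq0_of_ord (i : 'I_n.+1) : i != ord0 -> n%:R != 0 :> R.
Proof.
rewrite pnatr_eq0 -val_eqE/= -!lt0n => i0.
by rewrite (leq_trans i0)// -ltnS.
Qed.

Lemma rank_meanE i : i != ord0 ->
  rank_mean (rank^~ i) = (n%:R + 1) / 2 + (1 - mu).
Proof.
move=> i0; have n0 := natr_neq0_of_ord i0; apply: (mulfI n0).
rewrite (rank_mean_exch1 (fun _ b => b.+1%:R) i0).
rewrite rank_meanD rank_mean_cst sum_ord_succ.
rewrite (@eq_rank_mean _ (fun s => -1 * rank s ord0)); last by move=> s; rewrite mulN1r.
by rewrite rank_meanZ rank0_mean natrM -!natr1; field.
Qed.

Let v := kappa - mu ^+ 2.

Lemma rank_var i : i != ord0 ->
  rank_covariance i i = (n%:R ^+ 2 - 1) / 12 + n%:R * mu * (1 - mu) - (n%:R - 1) * v.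
Proof.
move=> i0; have n0 := natr_neq0_of_ord i0; rewrite rank_covarianceE (rank_meanE i0).
suff -> : rank_mean (fun s => rank s i * rank s i) =
  ((n.+1 * n.+2 * (2 * n.+1 + 1))%:R / 6 -
   (1 + 3 * n%:R * mu + n%:R * (n%:R - 1) * kappa)) / n%:R.
  by rewrite /v !natrM natrD natrM -!natr1; field.
apply: (mulfI n0); rewrite [RHS]mulrC divfK//.
rewrite (rank_mean_exch1 (fun _ b => b.+1%:R * b.+1%:R) i0).
rewrite rank_meanD rank_mean_cst sum_ord_succ_sqr -rank0_mean_sqr.
rewrite (@eq_rank_mean _ (fun s => -1 * (rank s ord0 * rank s ord0))).
  by rewrite rank_meanZ mulN1r.
by move=> s; rewrite mulN1r.
Qed.

Lemma rank0_var : rank_covariance ord0 ord0 = n%:R * (mu * (1 - mu) + (n%:R - 1) * v).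
Proof. by rewrite rank_covarianceE rank0_mean rank0_mean_sqr /v; ring. Qed.

Lemma rank0_cov i : i != ord0 ->
  rank_covariance ord0 i = - (mu * (1 - mu) + (n%:R - 1) * v).
Proof.
move=> i0; have n0 := natr_neq0_of_ord i0.
rewrite rank_covarianceE (rank_meanE i0) rank0_mean.
suff -> : rank_mean (fun s => rank s ord0 * rank s i) =
  ((n.+1 * n.+2)%:R / 2 * (1 + n%:R * mu) -
   (1 + 3 * n%:R * mu + n%:R * (n%:R - 1) * kappa)) / n%:R.
  by rewrite /v !natrM -!natr1; field.
apply: (mulfI n0); rewrite [RHS]mulrC divfK//.
rewrite (rank_mean_exch1 (fun a b => a.+1%:R * b.+1%:R) i0).
rewrite (@eq_rank_mean _ (fun s => (n.+1 * n.+2)%:R / 2 * rank s ord0 +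
   -1 * (rank s ord0 * rank s ord0))).
  by rewrite rank_meanD !rank_meanZ rank0_mean_sqr rank0_mean mulN1r.
by move=> s; rewrite -mulr_sumr sum_ord_succ /rank; ring.
Qed.

Lemma rank_cov i k : i != ord0 -> k != ord0 -> i != k ->
  rank_covariance i k = - ((n%:R + 1) / 12) + 2 * (v - mu * (1 - mu) / 2).
Proof.
move=> i0 k0 ik; have n0 := natr_neq0_of_ord i0.
have n1 : n.-1%:R != 0 :> R.
  rewrite pnatr_eq0 -lt0n -subn1 subn_gt0.
  (* If [n <= 1] then the two nonzero indices are both 1. *)
  rewrite ltnNge; apply: contra ik => n1; rewrite -val_eqE/=.
  move: (ltn_ord i) (ltn_ord k) i0 k0; rewrite -!val_eqE/= !ltnS.
  move=> /leq_trans/(_ n1) + /leq_trans/(_ n1).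
  by case: (nat_of_ord i) => [|[|]]//; case: (nat_of_ord k) => [|[|]].
have predn : n.-1%:R = n%:R - 1 :> R.
  by rewrite -subn1 natrB// lt0n -(@pnatr_eq0 R).
rewrite rank_covarianceE (rank_meanE i0) (rank_meanE k0).
pose S1 : R := (n.+1 * n.+2)%:R / 2.
(* [S1] is the sum of all ranks.  The numerator is the mean of the sum of
   [b * c] over all distinct ranks [b] and [c] different from [R_0], that is
   [(S1 - R_0)^2] minus the sum of the squares of these ranks. *)
suff -> : rank_mean (fun s => rank s i * rank s k) =
  (S1 ^+ 2 - (n.+1 * n.+2 * (2 * n.+1 + 1))%:R / 6 - 2 * S1 * (1 + n%:R * mu) +
   2 * (1 + 3 * n%:R * mu + n%:R * (n%:R - 1) * kappa)) / (n.-1%:R * n%:R).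
  rewrite /S1 /v predn !natrM natrD natrM -!natr1; field.
  by rewrite n0 -predn n1.
apply: (mulfI n1); apply: (mulfI n0).
rewrite [RHS]mulrCA [RHS]mulrA [RHS]mulrC divfK ?mulf_neq0//.
rewrite (rank_mean_exch2 (fun a b => a.+1%:R * b.+1%:R) i0 k0 ik).
rewrite (rank_mean_exch1 (fun a b => \sum_(c < n.+1) (b.+1%:R * c.+1%:R)
  - b.+1%:R * b.+1%:R - b.+1%:R * a.+1%:R) i0).
rewrite (@eq_rank_mean _ (fun s => S1 ^+ 2 - (n.+1 * n.+2 * (2 * n.+1 + 1))%:R / 6 +
   (- 2 * S1 * rank s ord0 + 2 * (rank s ord0 * rank s ord0)))).
  by rewrite !rank_meanD !rank_meanZ !rank_mean_cst rank0_mean_sqr rank0_mean /S1; ring.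
move=> s; rewrite !sumrB -big_distrlr/= -mulr_suml -mulr_sumr.
by rewrite sum_ord_succ sum_ord_succ_sqr /rank /S1; ring.
Qed.
End moments.
End exchangeable_ranks.

Local Open Scope classical_set_scope.
Local Open Scope ring_scope.

(** * Expectation over an almost sure finite partition *)

Section partition.
Context d (T : measurableType d) (R : realType) (P : probability T R).
Variables (I : finType) (D : pred I) (E : I -> set T).
Hypothesis mE : forall i, measurable (E i).

Lemma expectation_sum_indic (c : I -> R) :
  ('E_P[fun w => (\sum_(i | D i) c i * \1_(E i) w)%R])%E =
  (\sum_(i | D i) fine (P (E i)) * c i)%:E.
Proof.
rewrite unlock; under eq_integral do rewrite -sumEFin.
rewrite integral_sum//; last first.
  move=> i; under eq_fun do rewrite EFinM.
  by apply: integrableZl => //; exact: integrable_indic.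
rewrite -sumEFin; apply: eq_bigr => i _.
under eq_integral do rewrite EFinM.
rewrite integralZl//; last exact: integrable_indic.
by rewrite integral_indic// setIT EFinM fineK ?fin_num_measure// muleC.
Qed.

Hypothesis tE : forall i j w, D i -> D j -> E i w -> E j w -> i = j.

Let indic_out i j w : D i -> D j -> E i w -> j != i -> \1_(E j) w = 0 :> R.
Proof.
move=> Di Dj iw ji; rewrite indicE memNset// => jw.
by rewrite (tE Di Dj iw jw) eqxx in ji.
Qed.

Let indic_in i w : E i w -> \1_(E i) w = 1 :> R.
Proof. by move=> iw; rewrite indicE mem_set. Qed.

Lemma sum_indic_partition (c : I -> R) i w : D i -> E i w ->
  \sum_(j | D j) c j * \1_(E j) w = c i.
Proof.
move=> Di iw; rewrite (bigD1 i)//= (indic_in iw) mulr1 big1 ?addr0// => j.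
by move=> /andP[Dj ji]; rewrite (indic_out Di Dj iw ji) mulr0.
Qed.

Let measurable_sum_indic (c : I -> R) :
  measurable_fun [set: T] (fun w => \sum_(i | D i) c i * \1_(E i) w).
Proof.
under eq_fun do rewrite -big_filter.
apply: measurable_sum => i.
by apply: measurable_funM => //; exact: measurable_indic.
Qed.

Lemma partition_total : {ae P, forall w, exists2 i, D i & E i w} ->
  (\sum_(i | D i) P (E i) = 1)%E.
Proof.
move=> cover; transitivity ('E_P[fun w => (\sum_(i | D i) 1 * \1_(E i) w)%R])%E.
  rewrite expectation_sum_indic -sumEFin; apply: eq_bigr => i _.
  by rewrite mulr1 fineK ?fin_num_measure.
rewrite -(expectation_cst P 1) unlock; apply: ae_eq_integral => //.
- exact/measurable_EFinP.
- exact/measurable_EFinP.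
- apply: filterS cover => w [i Di iw] _; congr EFin.
  exact: (sum_indic_partition (fun=> 1) Di iw).
Qed.

Hypothesis E1 : (\sum_(i | D i) P (E i) = 1)%E.

(** The indicator of the union of the [E i] is the sum of their indicators, so
    this union has probability 1. *)
Lemma partition_ae : {ae P, forall w, exists2 i, D i & E i w}.
Proof.
pose U := \bigcup_(i in [set i | D i]) E i.
have mU : measurable U by exact: fin_bigcup_measurable.
exists (~` U); split.
- exact: measurableC.
- rewrite probability_setC// -(expectation_indic P mU).
  have -> : \1_U = (fun w => \sum_(i | D i) 1 * \1_(E i) w) :> (T -> R).
    apply/funext => w; have [[i Di iw]|nU] := pselect (U w).
      rewrite indicE mem_set; last by exists i.
      by rewrite (@sum_indic_partition (fun=> 1) _ _ Di iw).
    rewrite indicE memNset// big1// => i Di.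
    by rewrite indicE memNset ?mulr0// => iw; apply: nU; exists i.
  rewrite expectation_sum_indic (eq_bigr (fun i => fine (P (E i)))); last first.
    by move=> i _; rewrite mulr1.
  rewrite -sumEFin (eq_bigr (fun i => P (E i))) ?E1 ?subee// => i _.
  by rewrite fineK ?fin_num_measure.
- by apply: subsetC => w [i Di iw]; exists i.
Qed.

(** Almost everywhere, [g] is the combination of the indicators of the [E i] with
    coefficients [f i]. *)
Lemma expectation_partition (g : T -> R) (f : I -> R) :
  measurable_fun [set: T] g -> (forall i w, D i -> E i w -> g w = f i) ->
  ('E_P[g])%E = (\sum_(i | D i) fine (P (E i)) * f i)%:E.
Proof.
move=> mg gf; rewrite -expectation_sum_indic unlock; apply: ae_eq_integral => //.
- exact/measurable_EFinP.
- exact/measurable_EFinP.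
- apply: filterS partition_ae => w [i Di iw] _; congr EFin.
  by rewrite (sum_indic_partition f Di iw) (gf i).
Qed.

(** The expectation of the indicator of [A], which is constant on each [E i]. *)
Lemma probability_partition (A : set T) (Q : pred I) : measurable A ->
  (forall i w, D i -> E i w -> A w <-> Q i) ->
  P A = (\sum_(i | D i && Q i) fine (P (E i)))%:E.
Proof.
move=> mA AQ; rewrite -(expectation_indic P mA).
rewrite (@expectation_partition _ (fun i => (Q i)%:R)).
- congr EFin; rewrite big_mkcondr; apply: eq_bigr => i _.
  by case: (Q i); rewrite ?mulr1 ?mulr0.
- exact: measurable_indic.
- move=> i w Di iw; rewrite indicE; congr (nat_of_bool _)%:R.
  apply/idP/idP => [/set_mem|Qi]; first by move/(AQ _ _ Di iw).
  exact/mem_set/(AQ _ _ Di iw).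
Qed.

Lemma covariance_partition (g h : T -> R) (f k : I -> R) :
  measurable_fun [set: T] g -> measurable_fun [set: T] h ->
  (forall i w, D i -> E i w -> g w = f i) ->
  (forall i w, D i -> E i w -> h w = k i) ->
  let p i := fine (P (E i)) in
  let m f := \sum_(i | D i) p i * f i in
  covariance P g h = (\sum_(i | D i) p i * ((f i - m f) * (k i - m k)))%:E.
Proof.
move=> mg mh gf hk p m; rewrite unlock.
rewrite (expectation_partition mg gf) (expectation_partition mh hk).
apply: expectation_partition => /=.
  by apply: measurable_funM; apply: measurable_funB.
by move=> i w Di iw; rewrite !fctE/= (gf i)// (hk i).
Qed.

End partition.

(** * Uniform laws on finite sets *)

Section uniform.
Context d (T : measurableType d) (R : realType) (P : probability T R).
Context d' (T' : measurableType d') (Y : T -> T') (s : seq T').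
Hypothesis mY : forall y, measurable (Y @^-1` [set y]).
Hypothesis unifY : uniform_rv P Y s.
Hypothesis s0 : undup s != [::].
Let r := undup s.

Lemma expectation_uniform (g : T' -> R) : measurable_fun [set: T] (g \o Y) ->
  ('E_P[g \o Y])%E = ((\sum_(y <- r) g y) / (size r)%:R)%:E.
Proof.
move=> mg; pose y_ i := tnth (in_tuple r) i.
pose E i := Y @^-1` [set y_ i].
have PE i : P (E i) = ((size r)%:R^-1)%:E.
  by apply: unifY; rewrite -mem_undup; exact: mem_tnth.
have size0 : (size r)%:R != 0 :> R by rewrite pnatr_eq0 size_eq0.
rewrite (@expectation_partition _ _ _ P _ xpredT E _ _ _ _ (fun i => g (y_ i)))//.
- rewrite [in RHS]big_tnth mulr_suml; congr EFin; apply: eq_bigr => i _.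
  by rewrite PE mulrC.
- by move=> i; exact: mY.
- move=> i j w _ _ Ei Ej; have /eqP : y_ i = y_ j := etrans (esym Ei) Ej.
  rewrite /y_ !(tnth_nth (y_ i))/=.
  by rewrite nth_uniq ?undup_uniq// => /eqP; exact: val_inj.
- under eq_bigr do rewrite PE.
  by rewrite sumEFin sumr_const card_ord -[_^-1 *+ _]mulr_natl mulfV.
- by move=> i w _ /= ->.
Qed.

Lemma covariance_uniform (g h : T' -> R) :
  measurable_fun [set: T] (g \o Y) -> measurable_fun [set: T] (h \o Y) ->
  let m f := (\sum_(y <- r) f y) / (size r)%:R in
  covariance P (g \o Y) (h \o Y) =
  ((\sum_(y <- r) (g y - m g) * (h y - m h)) / (size r)%:R)%:E.
Proof.
move=> mg mh m; rewrite unlock !expectation_uniform// -/m /=.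
apply: (@expectation_uniform (fun y => (g y - m g) * (h y - m h))).
by apply: measurable_funM; apply: measurable_funB.
Qed.
End uniform.

Section uniform_moments.
Context (R : realType) (n : nat).

Lemma sum_iota (F : nat -> R) : \sum_(y <- iota 1 n) F y = \sum_(a < n) F a.+1.
Proof.
have -> : iota 1 n = index_iota 1 n.+1 by rewrite /index_iota subSS subn0.
by rewrite big_add1 /= big_mkord.
Qed.

Lemma uniq_distinct_pairs : uniq (distinct_pairs n).
Proof.
apply: filter_uniq; apply: allpairs_uniq; rewrite ?iota_uniq//.
by move=> [a b] [c e] _ _ [-> ->].
Qed.

Lemma sum_distinct_pairs (F : nat * nat -> R) :
  \sum_(y <- distinct_pairs n) F y =
  \sum_(a < n) (\sum_(b < n) F (a.+1, b.+1) - F (a.+1, a.+1)).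
Proof.
rewrite big_filter big_mkcond big_allpairs sum_iota; apply: eq_bigr => a _.
rewrite sum_iota [in RHS](bigD1 a)//= [RHS]addrAC subrr add0r.
by rewrite [RHS]big_mkcond/=; apply: eq_bigr => b _; rewrite eqSS eq_sym.
Qed.

Lemma size_distinct_pairs : (size (distinct_pairs n))%:R = n%:R * (n%:R - 1) :> R.
Proof.
rewrite -sum1_size natr_sum sum_distinct_pairs.
rewrite (eq_bigr (fun=> n%:R - 1)) => [|a _]; last by rewrite sumr_const card_ord.
by rewrite sumr_const card_ord mulr_natl.
Qed.

Lemma sum_deviation : \sum_(a < n) (a.+1%:R - (n%:R + 1) / 2) = 0 :> R.
Proof.
rewrite sumrB sum_ord_succ sumr_const card_ord -[_ / 2 *+ n]mulr_natl.
by rewrite natrM -natr1; field.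
Qed.

Lemma sum_sqr_deviation :
  \sum_(a < n) (a.+1%:R - (n%:R + 1) / 2) * (a.+1%:R - (n%:R + 1) / 2) =
  n%:R * (n%:R ^+ 2 - 1) / 12 :> R.
Proof.
set c := (n%:R + 1) / 2.
rewrite (eq_bigr (fun a : 'I_n => a.+1%:R * a.+1%:R + (- 2 * c * a.+1%:R + c ^+ 2))).
  rewrite !big_split/= -mulr_sumr sum_ord_succ sum_ord_succ_sqr sumr_const.
  rewrite card_ord -[c ^+ 2 *+ n]mulr_natl /c !natrM natrD natrM -natr1.
  by field.
by move=> a _; ring.
Qed.

Context d (T : measurableType d) (P : probability T R).

Lemma uniform_mean_var (U : {RV P >-> nat}) : (0 < n)%N ->
  uniform_rv P U (iota 1 n) ->
  ('E_P[fun w => (U w)%:R])%E = ((n%:R + 1) / 2)%:E /\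
  ('V_P[fun w => (U w)%:R])%E = ((n%:R ^+ 2 - 1) / 12)%:E.
Proof.
move=> n_gt0 unifU.
have n0 : n%:R != 0 :> R by rewrite pnatr_eq0 -lt0n.
have uI : undup (iota 1 n) = iota 1 n by rewrite undup_id// iota_uniq.
have uN : undup (iota 1 n) != [::] by rewrite uI -size_eq0 size_iota -lt0n.
have mU y : measurable (U @^-1` [set y]) by exact: measurable_funPTI.
have mg : measurable_fun [set: T] ((fun y => y%:R : R) \o U).
  by apply: measurableT_comp.
have meanE : (\sum_(y <- iota 1 n) y%:R) / n%:R = (n%:R + 1) / 2 :> R.
  by rewrite sum_iota sum_ord_succ natrM -natr1; field.
split.
  by rewrite (expectation_uniform mU unifU uN mg) uI size_iota meanE.
rewrite /variance (covariance_uniform mU unifU uN mg mg) uI size_iota meanE.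
by rewrite sum_iota sum_sqr_deviation; congr EFin; field.
Qed.

Lemma uniform_pair_cov (V W : {RV P >-> nat}) : (1 < n)%N ->
  uniform_rv P (fun w => (V w, W w)) (distinct_pairs n) ->
  covariance P (fun w => (V w)%:R) (fun w => (W w)%:R) = (- ((n%:R + 1) / 12))%:E.
Proof.
move=> n_gt1 unifVW.
have n0 : n%:R != 0 :> R by rewrite pnatr_eq0 -lt0n ltnW.
have n1 : n%:R - 1 != 0 :> R by rewrite subr_eq0 pnatr_eq1 gtn_eqF.
have uI : undup (distinct_pairs n) = distinct_pairs n.
  by rewrite undup_id// uniq_distinct_pairs.
have uN : undup (distinct_pairs n) != [::].
  by rewrite uI -size_eq0 -(@pnatr_eq0 R) size_distinct_pairs mulf_neq0.
have mVW y : measurable ((fun w => (V w, W w)) @^-1` [set y]).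
  case: y => a b.
  have -> : (fun w => (V w, W w)) @^-1` [set (a, b)] =
      V @^-1` [set a] `&` W @^-1` [set b].
    by apply/seteqP; split => w /= [-> ->].
  by apply: measurableI; exact: measurable_funPTI.
pose g (y : nat * nat) : R := y.1%:R.
pose h (y : nat * nat) : R := y.2%:R.
have mg : measurable_fun [set: T] (g \o (fun w => (V w, W w))).
  rewrite [X in measurable_fun _ X](_ : _ = (fun y => y%:R) \o V)//.
  by apply: measurableT_comp.
have mh : measurable_fun [set: T] (h \o (fun w => (V w, W w))).
  rewrite [X in measurable_fun _ X](_ : _ = (fun y => y%:R) \o W)//.
  by apply: measurableT_comp.
have meang : (\sum_(y <- distinct_pairs n) g y) / (n%:R * (n%:R - 1)) = (n%:R + 1) / 2.
  rewrite sum_distinct_pairs /g/= (eq_bigr (fun a : 'I_n => (n%:R - 1) * a.+1%:R)).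
    by rewrite -mulr_sumr sum_ord_succ natrM -natr1; field; rewrite ?n0 ?n1.
  by move=> a _; rewrite sumr_const card_ord -[_ *+ n]mulr_natl; ring.
have meanh : (\sum_(y <- distinct_pairs n) h y) / (n%:R * (n%:R - 1)) = (n%:R + 1) / 2.
  rewrite sum_distinct_pairs /h/= sumrB sumr_const card_ord -[_ *+ n]mulr_natl.
  by rewrite sum_ord_succ natrM -natr1; field; rewrite ?n0 ?n1.
have covE := covariance_uniform mVW unifVW uN mg mh.
rewrite /= uI size_distinct_pairs meang meanh in covE.
apply: etrans covE _; congr EFin.
rewrite sum_distinct_pairs /g /h/= sumrB -big_distrlr/=.
rewrite sum_deviation sum_sqr_deviation.
by field; rewrite ?n0 ?n1.
Qed.
End uniform_moments.

(** * Joint laws of independent variables *)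

Section boxes.
Context d (T : measurableType d) (R : realType) (N : nat).

Definition box (B : 'I_N -> set T) : set (N.-tuple T) :=
  [set t | forall i, B i (tnth t i)].

Lemma measurable_box B : (forall i, measurable (B i)) -> measurable (box B).
Proof.
move=> mB; have -> : box B = \bigcap_(i in [set: 'I_N]) ((@tnth _ T ^~ i) @^-1` B i).
  by apply/seteqP; split => [t h i _|t h i]; [exact: h|exact: (h i I)].
apply: fin_bigcap_measurable => // i _.
by rewrite -[X in measurable X]setTI; exact: measurable_tnth.
Qed.

(** Boxes are stable by intersection and generate the product sigma-algebra. *)
Lemma eq_measure_boxes (m1 m2 : {finite_measure set (N.-tuple T) -> \bar R}) :
  (forall B, (forall i, measurable (B i)) -> m1 (box B) = m2 (box B)) ->
  forall A, measurable A -> m1 A = m2 A.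
Proof.
move=> m12 A mA.
pose G : set (set (N.-tuple T)) :=
  [set C | exists2 B, (forall i, measurable (B i)) & C = box B].
apply: (@g_sigma_algebra_measure_unique _ _ _ G _ (fun=> setT)).
- by move=> _ [B mB ->]; exact: measurable_box.
- move=> _; exists (fun=> setT) => //.
  by apply/seteqP; split.
- by rewrite bigcup_const.
- move=> _ _ [B mB ->] [C mC ->]; exists (fun i => B i `&` C i).
    by move=> i; exact: measurableI.
  by apply/seteqP; split => [t [Bt Ct] i|t BC]; [split|split => i; case: (BC i)].
- by move=> _ [B mB ->]; exact: m12.
- by move=> _; rewrite -ge0_fin_numE// fin_num_measure.
move: A mA; apply: smallest_sub; first exact: smallest_sigma_algebra.
move=> C; rewrite -bigcup_seq => -[i _ [B mB <-]].
apply: sub_sigma_algebra; exists (fun j => if j == i then B else setT).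
  by move=> j; case: ifP.
rewrite setTI; apply/seteqP; split => [t Bt j|t /(_ i)]; last by rewrite eqxx.
by case: eqP => [->|].
Qed.
End boxes.

Section independence.
Context d (T : measurableType d) (R : realType) (P : probability T R).

Section pair.
Context d1 d2 (T1 : measurableType d1) (T2 : measurableType d2).
Variables (Y : {mfun T >-> T1}) (W : {mfun T >-> T2}).
Hypothesis YW : forall A B, measurable A -> measurable B ->
  P (Y @^-1` A `&` W @^-1` B) = (P (Y @^-1` A) * P (W @^-1` B))%E.

(** Conditioning on [Y]: by uniqueness of the product measure, the law of the pair
    is the product of the laws. *)
Lemma probability_pair (E : set (T1 * T2)) : measurable E ->
  P [set w | E (Y w, W w)] = (\int[P]_w P [set w' | E (Y w, W w')])%E.
Proof.
move=> mE.
have mYW : measurable_fun [set: T] (fun w => (Y w, W w)).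
  by apply/measurable_fun_pairP; split; exact: measurable_funP.
pose YWm : {mfun T >-> (T1 * T2)%type} := HB.pack (fun w => (Y w, W w))
  (isMeasurableFun.Build _ _ _ _ _ mYW).
transitivity ((distribution P Y \x distribution P W)%E E).
  symmetry; exact: (@product_measure_unique _ _ _ _ _ (distribution P Y)
    (distribution P W) (distribution P YWm)).
rewrite /product_measure1/= ge0_integral_distribution//.
- by apply: eq_integral => w _ /=; congr (P _); apply/seteqP; split => w' /= /xsectionP.
- exact: measurable_fun_xsection.
Qed.
End pair.

Variables (N : nat) (X : 'I_N -> {RV P >-> R}).
Hypothesis indX : mutually_independent X.

Lemma indep2 i j A B : i != j -> measurable A -> measurable B ->
  P (X i @^-1` A `&` X j @^-1` B) = (P (X i @^-1` A) * P (X j @^-1` B))%E.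
Proof.
move=> ij mA mB.
have := indX [set i; j]%SET (B := fun k => if k == i then A else B).
rewrite !big_setU1/= ?inE// !big_set1 eqxx eq_sym (negbTE ij); apply.
by move=> k; case: ifP.
Qed.

Lemma indep3 i j k A B C : i != j -> i != k -> j != k ->
  measurable A -> measurable B -> measurable C ->
  P (X i @^-1` A `&` (X j @^-1` B `&` X k @^-1` C)) =
  (P (X i @^-1` A) * (P (X j @^-1` B) * P (X k @^-1` C)))%E.
Proof.
move=> ij ik jk mA mB mC.
have := indX (i |: [set j; k])%SET
  (B := fun l => if l == i then A else if l == j then B else C).
rewrite !big_setU1/= ?inE ?negb_or ?ij ?ik// !big_set1 !eqxx.
rewrite (eq_sym j) (eq_sym k) (eq_sym k) (negbTE ij) (negbTE ik) (negbTE jk); apply.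
by move=> l; case: ifP => // _; case: ifP.
Qed.

Let mpair j k : measurable_fun [set: T] (fun w => (X j w, X k w)).
Proof. by apply/measurable_fun_pairP; split; exact: measurable_funP. Qed.

(** For a fixed [A], both sides are finite measures in [B] that agree on
    rectangles. *)
Lemma indep_pair i j k (A : set R) (B : set (R * R)) :
  i != j -> i != k -> j != k -> measurable A -> measurable B ->
  P (X i @^-1` A `&` (fun w => (X j w, X k w)) @^-1` B) =
  (P (X i @^-1` A) * P ((fun w => (X j w, X k w)) @^-1` B))%E.
Proof.
move=> ij ik jk mA mB.
pose W : {mfun T >-> (R * R)%type} := HB.pack (fun w => (X j w, X k w))
  (isMeasurableFun.Build _ _ _ _ _ (mpair j k)).
have mXA : measurable (X i @^-1` A) by exact: measurable_funPTI.
have pA0 : 0 <= fine (P (X i @^-1` A)) by exact: fine_ge0.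
have mW : measurable_fun [set: T] W by exact: mpair.
(* The measure structure of a pushforward depends on the measurability of the
   map, so [restricted] is a function of a proof of it. *)
pose restricted : {measure set (R * R) -> \bar R} :=
  pushforward (mrestr P mXA) W.
pose m1 := restricted mW.
pose m2 : {measure set (R * R) -> \bar R} :=
  mscale (NngNum pA0) (distribution P W).
suff : m1 B = m2 B.
  by rewrite /m1 /restricted /m2 /= /pushforward /mrestr /mscale/=
    setIC fineK ?fin_num_measure.
pose G : set (set (R * R)) :=
  [set C `*` D | C in measurable & D in measurable].
apply: (measure_unique G (fun=> setT)) => //.
- exact: measurable_prod_measurableType.
- move=> _ _ [C1 mC1 [D1 mD1 <-]] [C2 mC2 [D2 mD2 <-]]; rewrite -setXI.
  exists (C1 `&` C2); first exact: measurableI.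
  by exists (D1 `&` D2) => //; exact: measurableI.
- by move=> _; exists setT => //; exists setT => //; rewrite setXTT.
- by rewrite bigcup_const.
- move=> _ [C mC [D mD <-]].
  rewrite /m1 /restricted /m2 /= /pushforward /mrestr /mscale/=
    fineK ?fin_num_measure//.
  rewrite setIC [LHS]indep3//; congr (_ * _)%E.
  by rewrite -indep2.
- move=> _; rewrite /m1 /restricted/= /pushforward /mrestr/=.
  apply: (le_lt_trans (probability_le1 P _)); last exact: ltry.
  by apply: measurableI => //; rewrite -[X in measurable X]setTI; exact: mpair.
Qed.

Definition sample_tuple (t : 'S_N) w : N.-tuple R := [tuple X (t i) w | i < N].

Lemma measurable_sample_tuple t : measurable_fun [set: T] (sample_tuple t).
Proof.
apply/measurable_fun_tnthP => i.
rewrite (_ : _ \o _ = X (t i)); first exact: measurable_funP.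
by apply/funext => w /=; rewrite tnth_mktuple.
Qed.

(** Independence makes the probability of a box a product over the coordinates;
    reindexing it by [t] changes no factor, since [X (t i)] and [X i] have the
    same law. *)
Lemma sample_exchangeable (t : 'S_N) (A : set (N.-tuple R)) :
  (forall i B, measurable B -> P (X (t i) @^-1` B) = P (X i @^-1` B)) ->
  measurable A -> P (sample_tuple t @^-1` A) = P (sample_tuple 1 @^-1` A).
Proof.
move=> tX mA.
pose S u : {mfun T >-> N.-tuple R} := HB.pack (sample_tuple u)
  (isMeasurableFun.Build _ _ _ _ _ (measurable_sample_tuple u)).
have boxE u B : sample_tuple u @^-1` box B =
    \big[setI/setT]_(i in [set: 'I_N]%SET) X i @^-1` B ((u^-1)%g i).
  rewrite (eq_bigl xpredT); last by move=> i; rewrite inE.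
  rewrite (reindex_inj (@perm_inj _ u))/= -bigcap_seq; apply/seteqP; split => w /=.
    by move=> h i _ /=; have := h i; rewrite tnth_mktuple permK.
  move=> h i; rewrite tnth_mktuple.
  by have := h i (mem_index_enum i); rewrite /= permK.
have boxP u B : (forall i, measurable (B i)) -> P (sample_tuple u @^-1` box B) =
    (\prod_(i < N) P (X i @^-1` B ((u^-1)%g i)))%E.
  move=> mB; rewrite boxE.
  have /= -> := indX [set: 'I_N]%SET (B := fun i => B ((u^-1)%g i)) (fun i => mB _).
  by apply: eq_bigl => i; rewrite inE.
apply: (@eq_measure_boxes _ _ _ _ (distribution P (S t))
  (distribution P (S 1%g))) => // B mB.
apply: etrans (boxP _ _ mB) _; apply: etrans (esym (boxP _ _ mB)).
rewrite (reindex_inj (@perm_inj _ t))/=; apply: eq_bigr => i _.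
by rewrite permK tX// invg1 perm1.
Qed.

End independence.

(** * Ranks *)

Section rank_events.
Context d (T : measurableType d) (R : realType) (n : nat).
Variable X : 'I_n.+1 -> T -> R.

(** The strict case: if [X i w < X j w] then [j] is counted in its own rank and not
    in the rank of [i]. *)
Lemma sample_rank_le i j w :
  (sample_rank X j w <= sample_rank X i w)%N = (X j w <= X i w).
Proof.
have [le_ji|lt_ij] := leP (X j w) (X i w).
  apply: leq_sum => k _; have [le_kj|//] := boolP (X k w <= X j w).
  by rewrite (le_trans le_kj le_ji).
apply/negbTE; rewrite -ltnNge /sample_rank (bigD1 j)//= [X in (_ < X)%N](bigD1 j)//=.
rewrite lexx leNgt lt_ij add0n add1n ltnS; apply: leq_sum => k _.
have [le_ki|//] := boolP (X k w <= X i w).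
by rewrite (le_trans le_ki (ltW lt_ij)).
Qed.

Definition rank_event (s : 'S_n.+1) : set T :=
  [set w | forall i, sample_rank X i w = (s i).+1].

Lemma rank_event_uniq s t w : rank_event s w -> rank_event t w -> s = t.
Proof.
by move=> sw tw; apply/permP => i; apply/val_inj/succn_inj; rewrite -sw -tw.
Qed.

(** Without ties the rank is an injective function of the index, with values
    between [1] and [n.+1]. *)
Lemma rank_event_cover w : injective (X^~ w) -> exists s, rank_event s w.
Proof.
move=> XI.
have rank_gt0 i : (0 < sample_rank X i w)%N.
  by rewrite /sample_rank (bigD1 i)//= lexx.
have rank_le i : (sample_rank X i w <= n.+1)%N.
  rewrite -[X in (_ <= X)%N]card_ord -sum1_card.
  by apply: leq_sum => k _; exact: leq_b1.
pose f i : 'I_n.+1 := inord (sample_rank X i w).-1.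
have fE i : (f i).+1 = sample_rank X i w.
  by rewrite /f inordK prednK// rank_gt0.
have fI : injective f.
  move=> i j fij; apply: XI; apply/eqP; rewrite eq_le -!sample_rank_le.
  by rewrite -!fE fij leqnn.
by exists (perm fI) => i; rewrite permE fE.
Qed.

Hypothesis mX : forall i, measurable_fun [set: T] (X i).

Lemma measurable_sample_rank i :
  measurable_fun [set: T] (fun w => (sample_rank X i w)%:R : R).
Proof.
have -> : (fun w => (sample_rank X i w)%:R) =
    (fun w => \sum_(j < n.+1) \1_[set w | X j w <= X i w] w) :> (T -> R).
  apply/funext => w; rewrite /sample_rank natr_sum; apply: eq_bigr => j _.
  by rewrite indicE mem_setE.
apply: measurable_sum => j; apply: measurable_indic.
by rewrite -[X in measurable X]setTI; exact: measurable_fun_le.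
Qed.

Lemma measurable_rank_eq i k : measurable [set w | sample_rank X i w = k].
Proof.
have -> : [set w | sample_rank X i w = k] =
    (fun w => (sample_rank X i w)%:R : R) @^-1` [set k%:R].
  by apply/seteqP; split => w /=; [move=> ->|move/eqP; rewrite eqr_nat => /eqP].
by rewrite -[X in measurable X]setTI; exact: measurable_sample_rank.
Qed.

Lemma measurable_rank_event s : measurable (rank_event s).
Proof.
have -> : rank_event s =
    \bigcap_(i in [set: 'I_n.+1]) [set w | sample_rank X i w = (s i).+1].
  by apply/seteqP; split => w h i; [move=> _; exact: h|exact: (h i I)].
by apply: fin_bigcap_measurable => // i _; exact: measurable_rank_eq.
Qed.
End rank_events.

(** * The standard normal distribution function *)

Lemma normal_prob_standardize (R : realType) (m s x : R) : 0 < s ->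
  normal_prob m s `]-oo, x] = normal_prob 0 1 `]-oo, ((x - m) / s)].
Proof.
move=> s0; have sn0 : s != 0 by rewrite gt_eqF.
(* Substitution along the increasing affine map [F]. *)
pose F (y : R^o) : R^o := (y - m) / s.
have F'E : F^`()%classic = cst s^-1.
  apply/funext => y; rewrite /F derive1E deriveM// deriveD// derive_cst scaler0.
  by rewrite add0r derive_id derive_cst addr0 scaler1.
rewrite /normal_prob -[_ / s]/(F x).
rewrite (@increasing_ge0_integration_by_substitutionNy R F).
- apply: eq_integral => y _; rewrite !fctE F'E !normal_pdfE ?oner_eq0//.
  congr EFin; rewrite /= [RHS]mulrAC; congr (_ * _).
    rewrite /normal_peak expr1n mul1r -mulrnAr sqrtrM ?sqr_ge0//.
    by rewrite sqrtr_sqr gtr0_norm// invfM mulrC.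
  congr expR; rewrite /F subr0 expr_div_n expr1n !mulNr; congr (- _).
  by rewrite -mulr_natr invfM mulrA.
- by move=> a b _ _ ab; rewrite /F ltr_pM2r ?invr_gt0// ltrD2r.
- by rewrite F'E => ? _; exact: cvg_cst.
- by rewrite F'E; exact: is_cvg_cst.
- by rewrite F'E; exact: cvg_cst.
- split; first by move=> y _; exact: ex_derive.
  apply: cvg_at_left_filter; apply: differentiable_continuous.
  by apply/derivable1_diffP; exact: ex_derive.
- apply/gt0_cvgMlNy; first by rewrite invr_gt0.
  exact: cvg_addrr_Ny.
- apply: continuous_subspaceT; apply: continuous_normal_pdf; exact: oner_neq0.
- by move=> y _; exact: normal_pdf_ge0.
Qed.

Section Phi_facts.
Context {R : realType}.

Lemma PhiE (x : R) : (Phi x)%:E = normal_prob 0 1 `]-oo, x].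
Proof. by rewrite /Phi fineK// fin_num_measure. Qed.

Lemma Phi_ge0 (x : R) : 0 <= Phi x.
Proof. by rewrite -lee_fin PhiE. Qed.

Lemma Phi_le1 (x : R) : Phi x <= 1.
Proof. by rewrite -lee_fin PhiE probability_le1. Qed.

Lemma measurable_Phi : measurable_fun [set: R] (@Phi R).
Proof.
apply: nondecreasing_measurable => // x y xy.
rewrite -lee_fin !PhiE le_measure ?inE//; exact: subset_itvl.
Qed.
End Phi_facts.

(** * The ranks of a normal sample *)

Section normal_sample.
Context (R : realType) d (T : measurableType d) (P : probability T R) (n : nat).
Variables (mu0 mu sigma0 sigma : R) (X : 'I_n.+1 -> {RV P >-> R}).
Hypothesis sigma_gt0 : 0 < sigma.
Hypothesis X0_normal : normal_rv (X ord0) mu0 sigma0.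
Hypothesis Xi_normal : forall i : 'I_n.+1, i != ord0 -> normal_rv (X i) mu sigma.
Hypothesis X_indep : mutually_independent X.

Lemma sample_cdf i x : i != ord0 ->
  P [set w | X i w <= x] = (Phi ((x - mu) / sigma))%:E.
Proof.
by move=> i0; rewrite PhiE -normal_prob_standardize// -(Xi_normal i0).
Qed.

Lemma sample_atomless i x : P [set w | x = X i w] = 0%E.
Proof.
have -> : [set w | x = X i w] = X i @^-1` [set x].
  by apply/seteqP; split => w /= ->.
have [->|i0] := eqVneq i ord0.
  by rewrite [LHS]X0_normal// /normal_prob integral_set1.
by rewrite [LHS](Xi_normal i0)// /normal_prob integral_set1.
Qed.

(** Conditionally on [X i], the event says that [X j] takes a given value. *)
Lemma no_tie i j : i != j -> P [set w | X i w = X j w] = 0%E.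
Proof.
move=> ij.
have mE : measurable [set p : R * R | p.1 = p.2].
  have -> : [set p : R * R | p.1 = p.2] = (fun p => p.1 - p.2) @^-1` [set 0].
    apply/seteqP; split => p /= => [->|/eqP]; first by rewrite subrr.
    by rewrite subr_eq0 => /eqP.
  by rewrite -[X in measurable X]setTI; apply: measurable_funB.
rewrite (@probability_pair _ _ _ P _ _ _ _ (X i) (X j) _ _ mE); last first.
  by move=> A B; exact: indep2.
by under eq_integral do rewrite sample_atomless; rewrite integral0.
Qed.

Lemma distinct_ae : {ae P, forall w, injective (fun i => X i w)}.
Proof.
have : {ae P, forall w, forall ij : 'I_n.+1 * 'I_n.+1, ij.1 != ij.2 ->
    X ij.1 w <> X ij.2 w}.
  apply: filter_forall => -[i j] /=; have [_|ij] := eqVneq i j.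
    by apply: nearW.
  exists [set w | X i w = X j w]; split.
  - rewrite -[X in measurable X]setTI; have -> : [set w | X i w = X j w] =
        (fun w => X i w - X j w) @^-1` [set 0].
      apply/seteqP; split => w /= => [->|/eqP]; first by rewrite subrr.
      by rewrite subr_eq0 => /eqP.
    by apply: measurable_funB.
  - exact: no_tie.
  - by move=> w /= /not_implyP[_ /contrapT].
apply: filterS => w h i j /eqP Xij; apply/eqP/negPn/negP => ij.
by apply: (h (i, j) ij); apply/eqP.
Qed.

Let Y i : T -> R := X i.

Let mY i : measurable_fun [set: T] (Y i).
Proof. exact: measurable_funP. Qed.

Lemma rank_event_total : (\sum_s P (rank_event Y s) = 1)%E.
Proof.
apply: partition_total.
- by move=> s; exact: measurable_rank_event.
- by move=> s t w _ _; exact: rank_event_uniq.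
- apply: filterS distinct_ae => w XI.
  by have [s sw] := @rank_event_cover _ _ _ _ Y w XI; exists s.
Qed.

(** The ranks of the sample permuted by [u^-1] are the permuted ranks, so the
    event for [u * s] is the event for [s] read on the permuted sample; a
    permutation that fixes [ord0] only exchanges variables of the same law. *)
Lemma rank_event_exch (t s : 'S_n.+1) : t ord0 = ord0 ->
  P (rank_event Y (t * s)%g) = P (rank_event Y s).
Proof.
move=> t0; pose C i (u : n.+1.-tuple R) : R := tnth u i.
have mC i : measurable_fun [set: n.+1.-tuple R] (C i) by exact: measurable_tnth.
have evE u : rank_event Y (u * s)%g = sample_tuple X (u^-1)%g @^-1` rank_event C s.
  apply/seteqP; split => w /= h i.
    have := h ((u^-1)%g i); rewrite permM permKV => <-.
    rewrite /sample_rank [RHS](reindex_inj (@perm_inj _ (u^-1)%g)).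
    by apply: eq_bigr => j _; rewrite /C !tnth_mktuple.
  have := h (u i); rewrite permM => <-.
  rewrite /sample_rank [LHS](reindex_inj (@perm_inj _ (u^-1)%g)).
  by apply: eq_bigr => j _; rewrite /C !tnth_mktuple permK.
rewrite evE sample_exchangeable//; first last.
- exact: measurable_rank_event.
- move=> i B mB; have [->|i0] := eqVneq i ord0.
    by rewrite -[in LHS]t0 permK.
  have ti0 : (t^-1)%g i != ord0.
    by rewrite -(inj_eq (@perm_inj _ t)) permKV t0.
  by rewrite [LHS](Xi_normal ti0)// [RHS](Xi_normal i0).
- by rewrite -[in RHS](mul1g s) evE invg1.
Qed.

Let Z w := Phi ((X ord0 w - mu) / sigma).

Lemma measurable_Z : measurable_fun [set: T] Z.
Proof.
apply: measurableT_comp; first exact: measurable_Phi.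
by apply: measurable_funM => //; apply: measurable_funB.
Qed.

(** Conditionally on [X ord0], the event has probability [Z]. *)
Lemma prob_below i : i != ord0 ->
  P [set w | X i w <= X ord0 w] = ('E_P[Z])%E.
Proof.
move=> i0.
have mE : measurable [set p : R * R | p.2 <= p.1].
  by rewrite -[X in measurable X]setTI; exact: measurable_fun_le.
rewrite (@probability_pair _ _ _ P _ _ _ _ (X ord0) (X i) _ _ mE); last first.
  by move=> A B; apply: indep2 => //; rewrite eq_sym.
by rewrite unlock; apply: eq_integral => w _; rewrite /= sample_cdf.
Qed.

(** Conditionally on [X ord0], the two events are independent of probability
    [Z]. *)
Lemma prob_below2 i j : i != ord0 -> j != ord0 -> i != j ->
  P [set w | X i w <= X ord0 w /\ X j w <= X ord0 w] = ('E_P[(Z ^+ 2)%R])%E.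
Proof.
move=> i0 j0 ij.
have mE : measurable [set p : R * (R * R) | p.2.1 <= p.1 /\ p.2.2 <= p.1].
  apply: measurableI.
  - rewrite -[X in measurable X]setTI; apply: measurable_fun_le => //.
    by apply: measurableT_comp.
  - rewrite -[X in measurable X]setTI; apply: measurable_fun_le => //.
    by apply: measurableT_comp.
have mW : measurable_fun [set: T] (fun w => (X i w, X j w)).
  by apply/measurable_fun_pairP; split; exact: measurable_funP.
pose W : {mfun T >-> (R * R)%type} := HB.pack (fun w => (X i w, X j w))
  (isMeasurableFun.Build _ _ _ _ _ mW).
rewrite (@probability_pair _ _ _ P _ _ _ _ (X ord0) W _ _ mE); last first.
  by move=> A B mA mB; apply: indep_pair => //; rewrite eq_sym.
rewrite unlock; apply: eq_integral => w _ /=.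
transitivity (P (X i @^-1` `]-oo, X ord0 w] `&` X j @^-1` `]-oo, X ord0 w])).
  by congr (P _); apply/seteqP; split => w' /=; rewrite !in_itv.
have cdfE k : k != ord0 -> P (X k @^-1` `]-oo, X ord0 w]) = (Z w)%:E.
  by move=> k0; rewrite -(sample_cdf _ k0); congr (P _); apply/seteqP;
    split => w' /=; rewrite in_itv.
by rewrite indep2// !cdfE// -EFinM.
Qed.


Lemma Z_ge0 w : 0 <= Z w. Proof. exact: Phi_ge0. Qed.

Let Z_le1 w : Z w <= 1. Proof. exact: Phi_le1. Qed.

Let integrable_unit (f : T -> R) : measurable_fun [set: T] f ->
  (forall w, 0 <= f w <= 1) -> P.-integrable [set: T] (EFin \o f).
Proof.
move=> mf f01; apply: measurable_bounded_integrable => //.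
  by rewrite -ge0_fin_numE// fin_num_measure.
exists 1; split; rewrite ?num_real// => x x1 w _ /=.
by have /andP[f0 f1] := f01 w; rewrite ger0_norm// (le_trans f1 (ltW x1)).
Qed.

Let Z2_01 w : 0 <= (Z ^+ 2) w <= 1.
Proof. by rewrite !fctE exprn_ge0 ?Z_ge0// exprn_ile1 ?Z_ge0// Z_le1. Qed.

Let measurable_Z2 : measurable_fun [set: T] (Z ^+ 2).
Proof. by rewrite expr2; apply: measurable_funM; exact: measurable_Z. Qed.

Let muZ := fine ('E_P[Z])%E.
Let kappaZ := fine ('E_P[(Z ^+ 2)%R])%E.

Lemma mean_Z : ('E_P[Z] = muZ%:E)%E.
Proof.
rewrite fineK// expectation_fin_num//; apply/Lfun1_integrable/integrable_unit.
  exact: measurable_Z.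
by move=> w; rewrite Z_ge0 Z_le1.
Qed.

Lemma mean_Z2 : ('E_P[(Z ^+ 2)%R] = kappaZ%:E)%E.
Proof.
by rewrite fineK// expectation_fin_num//; apply/Lfun1_integrable/integrable_unit.
Qed.

Lemma variance_Z : fine ('V_P[Z])%E = kappaZ - muZ ^+ 2.
Proof.
have ZL : Z \in Lfun P 1.
  apply/Lfun1_integrable/integrable_unit; first exact: measurable_Z.
  by move=> w; rewrite Z_ge0 Z_le1.
have Z2L : (Z * Z)%R \in Lfun P 1.
  by rewrite -expr2; apply/Lfun1_integrable/integrable_unit.
by rewrite /variance covarianceE// -expr2 mean_Z2 mean_Z -EFinM -EFinB.
Qed.

(** If the mean of [Z] is 0 or 1 then the division is by 0, but the variance
    vanishes too: [0 <= Z <= 1] gives [E Z^2 <= E Z], so that the variance is at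
    most [E Z * (1 - E Z)]. *)
Lemma intraclass_cancel :
  muZ * (1 - muZ) * (fine ('V_P[Z])%E / (muZ * (1 - muZ))) = fine ('V_P[Z])%E.
Proof.
have [e|ne] := eqVneq (muZ * (1 - muZ)) 0; last by rewrite mulrC divfK.
rewrite e mul0r.
have v0 : 0 <= kappaZ - muZ ^+ 2 by rewrite -variance_Z fine_ge0// variance_ge0.
have k0 : 0 <= kappaZ.
  by rewrite fine_ge0//; apply: expectation_ge0 => w; case/andP: (Z2_01 w).
have km : kappaZ <= muZ.
  rewrite -lee_fin -mean_Z2 -mean_Z; apply: expectation_le => //.
  - exact: measurable_Z.
  - by move=> w; case/andP: (Z2_01 w).
  - exact: Z_ge0.
  - by apply: nearW => w; rewrite !fctE expr2 ler_piMl ?Z_ge0 ?Z_le1.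
rewrite variance_Z; apply/esym/le_anti/andP; split=> //.
by move/eqP: e; rewrite mulf_eq0 => /orP[/eqP m|/eqP m]; nra.
Qed.

Let p (s : 'S_n.+1) : R := fine (P (rank_event Y s)).

Let PE s : P (rank_event Y s) = (p s)%:E.
Proof. by rewrite fineK ?fin_num_measure//; exact: measurable_rank_event. Qed.

Lemma rank_weight_sum1 : \sum_s p s = 1.
Proof.
by apply: EFin_inj; rewrite -sumEFin -rank_event_total; apply: eq_bigr => s _; rewrite PE.
Qed.

Lemma rank_weight_exch (t s : 'S_n.+1) : t ord0 = ord0 -> p (t * s)%g = p s.
Proof. by move=> t0; rewrite /p rank_event_exch. Qed.

Let mE s := measurable_rank_event mY s.
Let uE (s t : 'S_n.+1) (w : T) (_ _ : true) := @rank_event_uniq _ _ _ _ Y s t w.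

Lemma expectation_rank (g : T -> R) (f : 'S_n.+1 -> R) :
  measurable_fun [set: T] g -> (forall s w, rank_event Y s w -> g w = f s) ->
  ('E_P[g])%E = (rank_mean p f)%:E.
Proof.
move=> mg gf; apply: (expectation_partition mE uE rank_event_total) => //.
by move=> s w _; exact: gf.
Qed.

Lemma expectation_sample_rank i :
  ('E_P[fun w => (sample_rank Y i w)%:R])%E =
  (rank_mean p (fun s => (s i).+1%:R))%:E.
Proof.
by apply: expectation_rank => [|s w ->//]; exact: measurable_sample_rank.
Qed.

Lemma covariance_rank i j :
  covariance P (fun w => (sample_rank Y i w)%:R) (fun w => (sample_rank Y j w)%:R) =
  (rank_covariance p i j)%:E.
Proof.
apply: (covariance_partition mE uE rank_event_total
  (f := fun s : 'S_n.+1 => (s i).+1%:R) (k := fun s : 'S_n.+1 => (s j).+1%:R)).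
- exact: measurable_sample_rank.
- exact: measurable_sample_rank.
- by move=> s w _ ->.
- by move=> s w _ ->.
Qed.

Lemma probability_rank m (i j : 'I_m -> 'I_n.+1) :
  P [set w | forall k, sample_rank Y (i k) w = (j k).+1] =
  (\sum_(s : 'S_n.+1 | [forall k, s (i k) == j k]) p s)%:E.
Proof.
apply: (probability_partition mE uE rank_event_total).
  have -> : [set w | forall k, sample_rank Y (i k) w = (j k).+1] =
      \bigcap_(k in [set: 'I_m]) [set w | sample_rank Y (i k) w = (j k).+1].
    by apply/seteqP; split => w h k; [move=> _; exact: h|exact: (h k I)].
  by apply: fin_bigcap_measurable => // k _; exact: measurable_rank_eq.
move=> s w _ sw; split => [h|/forallP h k].
  by apply/forallP => k; apply/eqP/val_inj/succn_inj; rewrite -h sw.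
by rewrite sw (eqP (h k)).
Qed.

Lemma probability_rank1 i a :
  P [set w | sample_rank Y i w = a.+1] =
  (\sum_(s : 'S_n.+1 | val (s i) == a) p s)%:E.
Proof.
apply: (probability_partition mE uE rank_event_total).
  exact: measurable_rank_eq.
move=> s w _ sw; rewrite /= sw; split => [|/eqP ->//].
by move=> /succn_inj/eqP.
Qed.

Lemma rank_mean_below i : i != ord0 ->
  rank_mean p (fun s => (s i <= s ord0)%N%:R) = muZ.
Proof.
move=> i0; apply: EFin_inj; rewrite -mean_Z -(prob_below i0).
have mA : measurable [set w | X i w <= X ord0 w].
  by rewrite -[X in measurable X]setTI; exact: measurable_fun_le.
rewrite -(expectation_indic P mA); apply/esym/expectation_rank.
  exact: measurable_indic.
move=> s w sw; rewrite indicE mem_setE.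
by rewrite -(ltnS (s i)) -!sw (sample_rank_le Y).
Qed.

Lemma rank_mean_below2 i j : i != ord0 -> j != ord0 -> i != j ->
  rank_mean p (fun s => (s i <= s ord0)%N%:R * (s j <= s ord0)%N%:R) = kappaZ.
Proof.
move=> i0 j0 ij; apply: EFin_inj; rewrite -mean_Z2 -(prob_below2 i0 j0 ij).
have mA : measurable [set w | X i w <= X ord0 w /\ X j w <= X ord0 w].
  by apply: measurableI; rewrite -[X in measurable X]setTI; exact: measurable_fun_le.
rewrite -(expectation_indic P mA); apply/esym/expectation_rank.
  exact: measurable_indic.
move=> s w sw; rewrite indicE -natrM mulnb; congr (nat_of_bool _)%:R.
rewrite -(ltnS (s i)) -(ltnS (s j)) -!sw !(sample_rank_le Y).
by apply/idP/andP => [/set_mem//|h]; exact/mem_set.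
Qed.
End normal_sample.

(** * The proposition *)

Theorem proposition3p2 (R : realType) (d : measure_display)
    (T : measurableType d) (P : probability T R) (n : nat)
    (mu0 mu sigma0 sigma : R) (X : 'I_n.+1 -> {RV P >-> R})
    (n_ge1 : (1 <= n)%N) (sigma0_gt0 : 0 < sigma0) (sigma_gt0 : 0 < sigma)
    (X0_normal : normal_rv (X ord0) mu0 sigma0)
    (Xi_normal : forall i : 'I_n.+1, i != ord0 -> normal_rv (X i) mu sigma)
    (X_indep : mutually_independent X) :
  let rk (i : 'I_n.+1) : T -> nat := sample_rank (fun j => X j : T -> R) i in
  let rkR (i : 'I_n.+1) : T -> R := fun w => (rk i w)%:R in
  let i0 : 'I_n.+1 := ord0 in
  let i1 : 'I_n.+1 := inord 1 in
  let i2 : 'I_n.+1 := inord 2 in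
  let Z : T -> R := fun w => Phi ((X i0 w - mu) / sigma) in
  let muZ : R := fine ('E_P[Z])%E in
  let muZbar : R := 1 - muZ in
  let vZ : R := fine ('V_P[Z])%E in
  let iota_Z : R := vZ / (muZ * muZbar) in
  let muU : R := (n%:R + 1) / 2 in
  let vU : R := (n%:R ^+ 2 - 1) / 12 in
  let c12 : R := - ((n%:R + 1) / 12) in
  (* joint laws of the ranks *)
  (forall (m : nat) (i : 'I_m -> 'I_n.+1) (j : 'I_m.+1 -> nat),
      (1 <= m <= n)%N ->
      (forall k, (1 <= i k)%N) ->
      (forall k l : 'I_m, (k < l)%N -> (i k < i l)%N) ->
      (forall k, (1 <= j k <= n.+1)%N) ->
      injective j ->
      P [set w | rk i0 w = j ord0 /\
                 forall k : 'I_m, rk (i k) w = j (lift ord0 k)] =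
        (P [set w | rk i0 w = j ord0] * ((n ^_ m)%:R^-1)%:E)%E
      /\
      P [set w | forall k : 'I_m, rk (i k) w = j (lift ord0 k)] =
        ((1 - \sum_(k < m) P [set w | rk i0 w = j (lift ord0 k)])
         * ((n ^_ m)%:R^-1)%:E)%E)
  /\
  (* interpretation of muU, vU and c12 *)
  (forall (d' : measure_display) (T' : measurableType d')
      (Q : probability T' R) (U : {RV Q >-> nat}),
      uniform_rv Q U (iota 1 n) ->
      ('E_Q[fun w => (U w)%:R])%E = muU%:E /\
      ('V_Q[fun w => (U w)%:R])%E = vU%:E)
  /\
  ((2 <= n)%N ->
    forall (d' : measure_display) (T' : measurableType d')
      (Q : probability T' R) (V W : {RV Q >-> nat}),
      uniform_rv Q (fun w => (V w, W w)) (distinct_pairs n) ->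
      covariance Q (fun w => (V w)%:R) (fun w => (W w)%:R) = c12%:E)
  /\
  (* moments of the ranks *)
  [/\ ('E_P[rkR i1])%E = (muU + muZbar)%:E,
      ('V_P[rkR i1])%E =
        (vU + n%:R * muZ * muZbar * (1 - (n%:R - 1) * iota_Z / n%:R))%:E,
      covariance P (rkR i0) (rkR i1) =
        (- (muZ * muZbar * (1 + (n%:R - 1) * iota_Z)))%:E &
      ((2 <= n)%N ->
        covariance P (rkR i1) (rkR i2) =
          (c12 + 2 * muZ * muZbar * (iota_Z - 1 / 2))%:E)]
  /\
  ('E_P[rkR i0])%E = (1 + n%:R * muZ)%:E
  /\
  ('V_P[rkR i0])%E = (- (n%:R)%:E * covariance P (rkR i0) (rkR i1))%E.
Proof.
move=> rk rkR i0 i1 i2 Z muZ muZbar vZ iota_Z muU vU c12.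
pose mean_below := rank_mean_below sigma_gt0 X0_normal Xi_normal X_indep.
pose mean_below2 := rank_mean_below2 sigma_gt0 X0_normal Xi_normal X_indep.
pose sum1 := rank_weight_sum1 X0_normal Xi_normal X_indep.
pose exch := rank_weight_exch Xi_normal X_indep.
have n0 : n%:R != 0 :> R by rewrite pnatr_eq0 -lt0n.
have i1_neq0 : i1 != i0 by rewrite -val_eqE/= inordK.
have vE := intraclass_cancel mu sigma X.
have v_def := variance_Z mu sigma X.
split.
  move=> m i j /andP[m_gt0 mn] i_gt0 i_incr j_bnd j_inj.
  (* [a] holds the prescribed ranks lowered by 1, so that they are the values of
     a permutation, and [b] the list of indices with [ord0] put in front. *)
  pose a k : 'I_n.+1 := inord (j k).-1.
  have jE k : j k = (a k).+1.
    have /andP[jk0 jkn] := j_bnd k.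
    by rewrite /a inordK prednK.
  have a_inj : injective a by move=> k l kl; apply: j_inj; rewrite !jE kl.
  have al_inj : injective (a \o lift ord0) by exact: inj_comp a_inj lift_inj.
  have i_inj : injective i.
    move=> k l kl; apply: val_inj; apply/eqP; case: ltngtP => // /i_incr;
      by rewrite kl ltnn.
  have i_neq0 k : i k != ord0 by rewrite -val_eqE/= -lt0n; exact: i_gt0.
  pose b k := oapp i ord0 (unlift ord0 k).
  have b0 : b ord0 = ord0 by rewrite /b unlift_none.
  have bl k : b (lift ord0 k) = i k by rewrite /b liftK.
  have b_inj : injective b.
    rewrite /b => k l; case: unliftP => [k'|] ->; case: unliftP => [l'|] -> //=.
    - by move=> /i_inj ->.
    - by move/eqP; rewrite (negbTE (i_neq0 _)).
    - by move/esym/eqP; rewrite (negbTE (i_neq0 _)).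
  have prob0 c : P [set w | rk i0 w = c.+1] = _ :=
    probability_rank1 X0_normal Xi_normal X_indep ord0 c.
  split.
    have -> : [set w | rk i0 w = j ord0 /\ forall k, rk (i k) w = j (lift ord0 k)] =
        [set w | forall k, rk (b k) w = (a k).+1].
      apply/seteqP; split => w /=; [move=> [h0 h] k|move=> h].
        by case: (unliftP ord0 k) => [k'|] ->; rewrite -jE ?b0// bl.
      by split=> [|k]; rewrite jE -h ?b0// bl.
    rewrite [LHS](probability_rank X0_normal Xi_normal X_indep) jE prob0 -EFinM.
    by rewrite (joint_law0 exch b_inj b0 a_inj).
  have -> : [set w | forall k, rk (i k) w = j (lift ord0 k)] =
      [set w | forall k, rk (i k) w = ((a \o lift ord0) k).+1].
    by apply/seteqP; split => w /= h k; rewrite h jE.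
  rewrite [LHS](probability_rank X0_normal Xi_normal X_indep).
  rewrite (joint_law exch sum1 i_inj i_neq0 al_inj) EFinM EFinB -sumEFin.
  by congr ((_ - _) * _)%E; apply: eq_bigr => k _; rewrite jE prob0.
split; first by move=> d' T' Q U; exact: uniform_mean_var.
split; first by move=> n_ge2 d' T' Q V W; exact: uniform_pair_cov.
have mean i := expectation_sample_rank X0_normal Xi_normal X_indep i.
have cov i j := covariance_rank X0_normal Xi_normal X_indep i j.
have v_eq : vZ = muZ * muZbar * iota_Z by rewrite vE.
have cov0 : covariance P (rkR i0) (rkR i1) =
    (- (muZ * muZbar * (1 + (n%:R - 1) * iota_Z)))%:E.
  rewrite [LHS]cov (rank0_cov exch sum1 mean_below mean_below2 i1_neq0).
  by rewrite -v_def -/vZ v_eq -/muZ /muZbar; congr EFin; ring.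
split.
  split => //.
  - by rewrite [LHS]mean (rank_meanE exch sum1 mean_below i1_neq0).
  - rewrite [LHS]cov (rank_var exch sum1 mean_below mean_below2 i1_neq0).
    rewrite -v_def -/vZ v_eq -/muZ /muZbar /vU; congr EFin; field.
    exact: n0.
  - move=> n_ge2.
    have i2_neq0 : i2 != i0 by rewrite -val_eqE/= inordK.
    have i12 : i1 != i2 by rewrite -val_eqE/= !inordK// ltnW.
    rewrite [LHS]cov (rank_cov exch sum1 mean_below mean_below2 i1_neq0 i2_neq0 i12).
    by rewrite -v_def -/vZ v_eq -/muZ /muZbar /c12; congr EFin; field.
split; first by rewrite [LHS]mean (rank0_mean sum1 mean_below).
rewrite cov0 [LHS]cov (rank0_var sum1 mean_below mean_below2).
rewrite -v_def -/vZ v_eq -/muZ /muZbar -EFinN -EFinM; congr EFin; ring.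
Qed.
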